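(* Let $K$ be a field, $S=K[x_1,\ldots,x_n]$, let $I\subset S$ be a nonzero proper monomial ideal, and let $I=\bigcap_{i=1}^s Q_i$ be the irredundant presentation of $I$ as an intersection of primary monomial ideals. Let $P_i:=\sqrt{Q_i}$. If $P_i\not\subset\sum_{1\le j\le s,\, j\neq i}P_j$ for all $i\in\{1,\ldots,s\}$, then $\operatorname{sdepth}(S/I)\ge\operatorname{depth}(S/I)$, that is, Stanley's conjecture holds for $S/I$.
   Context: Depth is taken with respect to the graded maximal ideal $\mathfrak m=(x_1,\ldots,x_n)$ of $S$. An empty sum of ideals is the zero ideal. Stanley depth: let $M$ be a nonzero finitely generated multigraded ($\mathbb{Z}^n$-graded) $S$-module. For a homogeneous $z\in M$ and $Z\subseteq\{x_1,\ldots,x_n\}$, let $zK[Z]$ be the $K$-subspace of $M$ of all elements $zf$, $f\in K[Z]$; it is called a Stanley space of dimension $|Z|$ if it is a free $K[Z]$-module. A Stanley decomposition of $M$ is a presentation of $M$ as a finite direct sum (of $K$-vector spaces) of Stanley spaces $\mathcal{D}: M=\bigoplus_{i=1}^r z_iK[Z_i]$. Put $\operatorname{sdepth}\mathcal{D}=\min\{|Z_i| : i=1,\ldots,r\}$, and let $\operatorname{sdepth}(M)$ be the maximum of $\operatorname{sdepth}\mathcal{D}$ over all Stanley decompositions $\mathcal{D}$ of $M$. Stanley's conjecture for $M$ is the inequality $\operatorname{sdepth}(M)\ge\operatorname{depth}(M)$. *)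

(* Defs.v *)
From HB Require Import structures.
From mathcomp Require Import all_boot all_order all_algebra.
From mathcomp Require Export ring_quotient.
From mathcomp Require Export boolp classical_sets.
From mathcomp Require Export mpoly.

Set Implicit Arguments.
Unset Strict Implicit.
Unset Printing Implicit Defensive.

Import Order.TTheory GRing.Theory.

Local Open Scope classical_set_scope.
Local Open Scope ring_scope.
Local Open Scope quotient_scope.

(* [{ideal_quot I}] is a ring but carries no [R]-module structure in the
   library; [quotmod I] is the same type, seen as the [R]-module [R/I].
   An [idealr] is proper by definition. *)
Section QuotientModule.
Variables (R : comNzRingType) (I : idealr R).

Definition quotmod : Type := {ideal_quot I}.

HB.instance Definition _ := GRing.Zmodule.copy quotmod {ideal_quot I}.

Definition quotmod_pi (f : R) : quotmod := \pi_({ideal_quot I}) f.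

Definition quotmod_scale (f : R) (v : quotmod) : quotmod :=
  \pi_({ideal_quot I}) f * (v : {ideal_quot I}).

Fact quotmod_scaleA f g v :
  quotmod_scale f (quotmod_scale g v) = quotmod_scale (f * g) v.
Proof. by rewrite /quotmod_scale rmorphM mulrA. Qed.

Fact quotmod_scale1 : left_id 1 quotmod_scale.
Proof. by move=> v; rewrite /quotmod_scale rmorph1 mul1r. Qed.

Fact quotmod_scaleDr : right_distributive quotmod_scale +%R.
Proof. by move=> f u v; exact: mulrDr. Qed.

Fact quotmod_scaleDl v : {morph quotmod_scale^~ v : f g / f + g}.
Proof. by move=> f g; rewrite /quotmod_scale rmorphD; exact: mulrDl. Qed.

HB.instance Definition _ := GRing.Zmodule_isLmodule.Build R quotmod
  quotmod_scaleA quotmod_scale1 quotmod_scaleDr quotmod_scaleDl.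

End QuotientModule.

Section Ideals.
Variable R : comNzRingType.

Definition ideal_gen (G : set R) : set R :=
  [set f | exists (r : nat) (a g : 'I_r -> R),
     (forall i, G (g i)) /\ f = \sum_(i < r) a i * g i].

Definition radical (Q : set R) : set R := [set f | exists k : nat, Q (f ^+ k)].

(* Properness is part of [idealr]. *)
Definition primary_ideal (Q : idealr R) : Prop :=
  forall f g : R, f * g \in Q -> f \in Q \/ exists k : nat, g ^+ k \in Q.

Definition ideal_sum (T : finType) (A : pred T) (P : T -> set R) : set R :=
  [set f | exists g : T -> R,
     (forall j, A j -> P j (g j)) /\ f = \sum_(j | A j) g j].

Definition is_intersection (s : nat) (I : idealr R) (Q : 'I_s -> idealr R) :
    Prop :=
  forall f, f \in I <-> forall i, f \in Q i.

Definition irredundant (s : nat) (Q : 'I_s -> idealr R) : Prop :=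
  forall i, exists f, (forall j, j != i -> f \in Q j) /\ f \notin Q i.

End Ideals.

Section Polynomials.
Variables (K : fieldType) (n : nat).
Local Notation S := {mpoly K[n]}.

Definition monomial_ideal (I : idealr S) : Prop :=
  exists G : set 'X_{1..n}, [set` I] = ideal_gen [set ('X_[m] : S) | m in G].

Definition max_ideal : set S := ideal_gen (range (fun i : 'I_n => 'X_i : S)).

(* The subring K[Z] of S. *)
Definition subpoly (Z : {set 'I_n}) : set S :=
  [set f | forall m, m \in msupp f -> forall i, i \notin Z -> m i = 0%N].

End Polynomials.

Section Modules.
Variables (K : fieldType) (n : nat).
Local Notation S := {mpoly K[n]}.
Variable M : lmodType S.

(* The submodule (f_1, ..., f_d) M. *)
Definition seq_smul (fs : seq S) : set M :=
  [set v | exists w : 'I_(size fs) -> M, v = \sum_(i < size fs) fs`_i *: w i].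

Definition regular_seq (fs : seq S) : Prop :=
  (forall k, (k < size fs)%N -> forall v : M,
     seq_smul (take k fs) (fs`_k *: v) -> seq_smul (take k fs) v)
  /\ seq_smul fs != setT.

(* [supremum 0] is the least upper bound of a nonempty bounded set; regular
   sequences in the maximal ideal have length at most n when M is finitely
   generated. *)
Definition depth : nat :=
  supremum 0%N [set d | exists fs : seq S,
    [/\ size fs = d, forall f, f \in fs -> max_ideal f & regular_seq fs]].

Definition stanley_piece (z : M) (Z : {set 'I_n}) : set M :=
  [set f *: z | f in subpoly Z].

(* Freeness over K[Z]; a finite basis is no restriction, because it is only
   applied to the cyclic modules zK[Z]. *)
Definition free_over (Z : {set 'I_n}) (V : set M) : Prop :=
  exists (r : nat) (b : 'I_r -> M), (forall j, V (b j)) /\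
    forall v, V v -> exists! c : {ffun 'I_r -> S},
      (forall j, subpoly Z (c j)) /\ v = \sum_(j < r) c j *: b j.

(* [hom] is the set of homogeneous elements of the multigraded module M. *)
Definition stanley_decomposition (hom : set M)
    (r : nat) (z : 'I_r -> M) (Z : 'I_r -> {set 'I_n}) : Prop :=
  [/\ forall i, hom (z i),
      forall i, free_over (Z i) (stanley_piece (z i) (Z i))
    & forall v : M, exists! w : {ffun 'I_r -> M},
        (forall i, stanley_piece (z i) (Z i) (w i)) /\ v = \sum_(i < r) w i].

(* Since #|Z i| <= n, the unit n of the minimum matters only when r = 0, which
   cannot occur in a decomposition of a nonzero module. *)
Definition sdepth_decomposition (r : nat) (Z : 'I_r -> {set 'I_n}) : nat :=
  \big[minn/n]_(i < r) #|Z i|.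

Definition sdepth (hom : set M) : nat :=
  supremum 0%N [set d | exists (r : nat) (z : 'I_r -> M)
    (Z : 'I_r -> {set 'I_n}),
    stanley_decomposition hom z Z /\ sdepth_decomposition Z = d].

End Modules.

(* The degree a part of S/I is the line spanned by the class of x^a if a is a
   nonnegative vector, and 0 otherwise. *)
Definition quot_homogeneous (K : fieldType) (n : nat)
    (I : idealr {mpoly K[n]}) : set (quotmod I) :=
  [set v | exists (c : K) (m : 'X_{1..n}), v = quotmod_pi I (c *: 'X_[m])].

(* Main.v *)
Require Import Defs.
From mathcomp Require Import all_boot all_order all_algebra.

(** Write V_i for the set of variables generating P_i, W for the set of variables
    in no V_i, and put d = |W| + s - 1.  By hypothesis every V_i contains a
    private variable y_i, one that lies in no other V_j: otherwise every monomial
    of an element of P_i would lie in some other P_j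
    (exists_private_var).  The inequality holds because
    depth S/I <= d <= sdepth S/I.

    For sdepth S/I >= d (private_le_sdepth), split the monomials outside I
    according to the first i with x^m outside Q_i.  Fix the exponents of all
    variables except those in W and the y_j with j <> i, which are d free
    variables.  Each Q_j with j < i then only asks for a lower bound on the
    exponent of y_j, the other Q_j with j <> i ask for nothing, and Q_i involves
    no free variable, so what remains is one Stanley space in which the d free
    variables are unbounded.  Membership in the Q_j does not change when an
    exponent grows beyond a large N, so that cutting the fixed exponents at N
    leaves finitely many Stanley spaces, with even more unbounded variables.

    For depth S/I <= d (private_depth_le), a nonzero class in degree p of the
    Koszul cohomology of M on elements t of S bounds by p the length of every
    M-regular sequence in the radical of the ideal (t): by the long exact sequence
    of 0 -> M -> M -> M/fM -> 0, and since some power of f kills the cohomology,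
    a nonzero class in degree p yields one in degree p - 1 for M/fM
    (regular_step, regular_seq_size).  For t = (x_1^N, .., x_n^N) a class of
    degree d in S/I comes from topology.  In the relevant multidegree the Koszul
    complex computes, up to a shift of degrees, the cohomology of the simplicial
    complex whose facets are the complements of the V_i in their union.  Thanks to
    the private variables this complex retracts onto the boundary of the simplex
    on y_1, .., y_s, a sphere of dimension s - 2, and the pullback of the
    fundamental cocycle of that sphere is the class (cochain_closed,
    cochain_not_exact).  Working with cochains on all sequences of variables,
    instead of increasing ones, makes this pullback a mere composition. *)

Set Implicit Arguments.
Unset Strict Implicit.
Unset Printing Implicit Defensive.

Import Order.TTheory GRing.Theory.

Local Open Scope ring_scope.

(** * Ordered Koszul cochains *)

(** The differential of the Koszul complex of the family t with values in M,
    on cochains indexed by arbitrary sequences instead of increasing ones: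
    (d c)(i_0, .., i_p) is the alternating sum of the
    t_(i_k) c(.., i_(k-1), i_(k+1), ..).  With this recursive form no sign has
    to be computed, and a map of index sets pulls cochains back. *)
Fixpoint koszul_diff (R : pzRingType) (M : lmodType R) (T : Type) (t : T -> R)
    (c : seq T -> M) (s : seq T) : M :=
  if s is i :: s' then t i *: c s' - koszul_diff t (fun s0 => c (i :: s0)) s'
  else 0.

Definition omit (T : Type) (k : nat) (s : seq T) := take k s ++ drop k.+1 s.

Lemma size_omit (T : Type) k (s : seq T) :
  (k < size s)%N -> size (omit k s) = (size s).-1.
Proof.
move=> lt_k_s; rewrite /omit size_cat size_take size_drop lt_k_s.
by rewrite -subn1 subnS -subn1 addnBA ?subn_gt0 // subnKC // ltnW.
Qed.

Lemma nth_omit (T : Type) (x0 : T) k (s : seq T) i :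
  (k < size s)%N -> nth x0 (omit k s) i = nth x0 s (bump k i).
Proof.
move=> lt_k_s; rewrite /omit nth_cat size_take lt_k_s /bump.
case: ltnP => [lt_ik | le_ki]; first by rewrite nth_take // leqNgt lt_ik.
by rewrite nth_drop addSn subnKC // add1n.
Qed.

Section KoszulDiff.
Variables (R : pzRingType) (M : lmodType R) (T : Type) (t : T -> R).
Implicit Types (b c : seq T -> M) (s : seq T).

Lemma eq_koszul_diff b c s : b =1 c -> koszul_diff t b s = koszul_diff t c s.
Proof.
elim: s b c => //= i s IHs b c eq_bc; rewrite eq_bc.
by congr (_ - _); apply: IHs => s0; exact: eq_bc.
Qed.

Lemma koszul_diff0 s : koszul_diff t (fun=> 0 : M) s = 0.
Proof. by elim: s => //= i s ->; rewrite scaler0 subr0. Qed.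

Lemma koszul_diffD b c s :
  koszul_diff t (fun s0 => b s0 + c s0) s =
  koszul_diff t b s + koszul_diff t c s.
Proof.
elim: s b c => [|i s IHs] b c /=; first by rewrite addr0.
by rewrite IHs scalerDr opprD addrACA.
Qed.

Lemma koszul_diffN c s :
  koszul_diff t (fun s0 => - c s0) s = - koszul_diff t c s.
Proof.
elim: s c => [|i s IHs] c /=; first by rewrite oppr0.
by rewrite IHs scalerN opprB opprK addrC.
Qed.

Lemma koszul_diffB b c s :
  koszul_diff t (fun s0 => b s0 - c s0) s =
  koszul_diff t b s - koszul_diff t c s.
Proof. by rewrite koszul_diffD koszul_diffN. Qed.

Lemma koszul_diffE x0 c s :
  koszul_diff t c s =
  \sum_(k < size s) (-1) ^+ k *: (t (nth x0 s k) *: c (omit k s)).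
Proof.
elim: s c => [|i s IHs] c /=; first by rewrite big_ord0.
rewrite big_ord_recl expr0 scale1r IHs /omit /= drop0; congr (_ + _).
rewrite -sumrN; apply: eq_bigr => k _.
by rewrite exprS mulN1r scaleNr.
Qed.

End KoszulDiff.

Section KoszulDiffScale.
Variables (R : comPzRingType) (M : lmodType R) (T : Type) (t : T -> R).
Implicit Types (c : seq T -> M) (s : seq T).

Lemma koszul_diffZ a c s :
  koszul_diff t (fun s0 => a *: c s0) s = a *: koszul_diff t c s.
Proof.
elim: s c => [|i s IHs] c /=; first by rewrite scaler0.
by rewrite IHs scalerBr !scalerA mulrC.
Qed.

(** Prepending i is a homotopy from t_i to 0; by the
    recursive form of the differential, this makes the claim for i :: s an
    instance of the claim for s. *)
Lemma koszul_diff_diff c s : koszul_diff t (koszul_diff t c) s = 0.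
Proof.
elim: s c => //= i s IHs c.
by rewrite koszul_diffB koszul_diffZ IHs subr0 subrr.
Qed.

End KoszulDiffScale.

(** * Regular sequences and Koszul cohomology *)

Section Submodule.
Variables (K : fieldType) (n : nat) (M : lmodType {mpoly K[n]}).
Local Notation S := {mpoly K[n]}.
Implicit Types (fs : seq S) (f : S) (u v : M).

Lemma seq_smulP fs v : seq_smul fs v <->
  exists w : nat -> M, v = \sum_(i < size fs) fs`_i *: w i.
Proof.
split=> [[w ->]|[w ->]]; last by exists (fun i => w i).
exists (fun k => if insub k is Some i then w i else 0).
by apply: eq_bigr => i _; rewrite valK.
Qed.

Lemma seq_smul0 fs : @seq_smul K n M fs 0.
Proof.
by exists (fun=> 0); rewrite big1 // => i _; rewrite scaler0.
Qed.

Lemma seq_smulD fs u v :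
  seq_smul fs u -> seq_smul fs v -> seq_smul fs (u + v).
Proof.
move=> [wu ->] [wv ->]; exists (fun i => wu i + wv i).
by rewrite -big_split; apply: eq_bigr => i _; rewrite scalerDr.
Qed.

Lemma seq_smulZ fs f v : seq_smul fs v -> seq_smul fs (f *: v).
Proof.
move=> [w ->]; exists (fun i => f *: w i).
by rewrite scaler_sumr; apply: eq_bigr => i _; rewrite !scalerA mulrC.
Qed.

Lemma seq_smulN fs v : seq_smul fs v -> seq_smul fs (- v).
Proof. by move=> /(seq_smulZ (-1)); rewrite scaleN1r. Qed.

Lemma seq_smul_rcons fs f v :
  seq_smul (rcons fs f) v <-> exists u, seq_smul fs (v - f *: u).
Proof.
have sum_rcons (w : nat -> M) :
    \sum_(i < size (rcons fs f)) (rcons fs f)`_i *: w i =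
    \sum_(i < size fs) fs`_i *: w i + f *: w (size fs).
  rewrite size_rcons big_ord_recr /= nth_rcons ltnn eqxx; congr (_ + _).
  by apply: eq_bigr => i _; rewrite nth_rcons ltn_ord.
split=> [/seq_smulP[w ->] | [u /seq_smulP[w Dw]]].
  by exists (w (size fs)); rewrite sum_rcons addrK; apply/seq_smulP; exists w.
pose wu i := if (i < size fs)%N then w i else u.
apply/seq_smulP; exists wu; rewrite sum_rcons {2}/wu ltnn.
rewrite -[v in LHS](subrK (f *: u)) Dw /wu; congr (_ + _).
by apply: eq_bigr => i _; rewrite ltn_ord.
Qed.

End Submodule.

Section DepthBound.
Variables (K : fieldType) (n : nat) (M : lmodType {mpoly K[n]}).
Local Notation S := {mpoly K[n]}.
Variables (T : Type) (t : T -> S).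
Implicit Types (fs : seq S) (f : S) (b c : seq T -> M).

Definition zero_in_degree fs q c :=
  forall s, size s = q -> seq_smul fs (c s).

Definition cocycle_mod fs q c := zero_in_degree fs q.+1 (koszul_diff t c).

Definition coboundary_mod fs q c :=
  exists b, zero_in_degree fs q (fun s => c s - koszul_diff t b s).

Lemma zero_in_degree_diff fs q c :
  zero_in_degree fs q c -> zero_in_degree fs q.+1 (koszul_diff t c).
Proof.
move=> c0; case=> // i s [sz_s]; rewrite (koszul_diffE _ i).
elim/big_ind: _ => [||k _]; [exact: seq_smul0 | by move=> *; apply: seq_smulD|].
by do 2!apply: seq_smulZ; apply: c0; rewrite size_omit.
Qed.

(** Koszul cohomology is annihilated by the ideal generated by t: prepending i
    is a homotopy from multiplication by t_i to 0. *)
Lemma ideal_gen_coboundary fs q c f :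
  cocycle_mod fs q c -> ideal_gen (range t) f ->
  coboundary_mod fs q (fun s => f *: c s).
Proof.
move=> cyc_c [r [a [g [/= t_g ->]]]].
elim/big_ind: _ => [|f1 f2 [b1 Db1] [b2 Db2]|k _].
- exists (fun=> 0) => s _; rewrite scale0r koszul_diff0 subr0.
  exact: seq_smul0.
- exists (fun s => b1 s + b2 s) => s sz_s.
  by rewrite koszul_diffD scalerDl opprD addrACA; apply: seq_smulD; auto.
have [i _ <-] := t_g k; exists (fun s => a k *: c (i :: s)) => s sz_s.
rewrite koszul_diffZ -scalerA -scalerBr; apply: seq_smulZ.
by apply: (cyc_c (i :: s)); rewrite /= sz_s.
Qed.

(** From f c = d b one gets a class b modulo f, in degree one less, which is the
    preimage of c under the connecting map of 0 -> M -> M -> M/fM -> 0. *)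
Lemma regular_step fs f q c :
    (forall v : M, seq_smul fs (f *: v) -> seq_smul fs v) ->
    radical (ideal_gen (range t)) f ->
    cocycle_mod fs q c -> ~ coboundary_mod fs q c ->
  exists q' b, [/\ q = q'.+1, cocycle_mod (rcons fs f) q' b
                 & ~ coboundary_mod (rcons fs f) q' b].
Proof.
move=> f_reg [e f_e] + nbd_c.
(* Replace c by the last multiple f^j c which is not a coboundary. *)
have{f_e}: cocycle_mod fs q c -> coboundary_mod fs q (fun s => f ^+ e *: c s).
  by move=> cyc_c; apply: ideal_gen_coboundary.
elim: e c nbd_c => [|e IHe] c nbd_c bd_fc cyc_c.
  case: nbd_c; have [b Db] := bd_fc cyc_c; exists b => s /Db.
  by rewrite expr0 scale1r.
have cyc_fc : cocycle_mod fs q (fun s => f *: c s).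
  by move=> s sz_s; rewrite koszul_diffZ; apply/seq_smulZ/cyc_c.
have [|nbd_fc] := pselect (coboundary_mod fs q (fun s => f *: c s)); last first.
  apply: (IHe _ nbd_fc) => // _; have [b Db] := bd_fc cyc_c.
  by exists b => s /Db; rewrite scalerA -exprSr.
case=> b; case: q nbd_c cyc_c {cyc_fc bd_fc IHe} => [|q] nbd_c cyc_c Db.
  (* In degree 0 the differential vanishes, so that f c = 0. *)
  case: nbd_c; exists b => s sz_s; apply: f_reg; move: (Db s sz_s).
  by case: s sz_s => //= _; rewrite !subr0.
exists q, b; split=> // [s sz_s|[u Du]].
  apply/seq_smul_rcons; exists (c s); rewrite -opprB.
  exact/seq_smulN/Db.
have v_ex s : exists v, size s = q ->
    seq_smul fs (b s - koszul_diff t u s - f *: v).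
  have [/eqP sz_s|/eqP nsz_s] := boolP (size s == q); last by exists 0.
  by have /seq_smul_rcons[v Dv] := Du s sz_s; exists v.
have [v Dv] := choice v_ex; apply: nbd_c; exists v => s sz_s; apply: f_reg.
have /(_ s sz_s) := zero_in_degree_diff Dv.
rewrite koszul_diffB koszul_diffZ koszul_diffB koszul_diff_diff subr0.
move=> /(seq_smulD (Db s sz_s)).
by rewrite addrA subrK -scalerBr.
Qed.

(** Each member of a regular sequence lowers the degree of a nonzero Koszul
    cohomology class by one. *)
Lemma regular_seq_size fs p c :
    @regular_seq K n M fs ->
    (forall f, f \in fs -> radical (ideal_gen (range t)) f) ->
    cocycle_mod [::] p c -> ~ coboundary_mod [::] p c ->
  (size fs <= p)%N.
Proof.
move=> [fs_reg _] fs_rad cyc_c nbd_c.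
suff /(_ _ (leqnn _)) [q [b [-> _ _]]] : forall k, (k <= size fs)%N ->
    exists q b, [/\ p = (k + q)%N, cocycle_mod (take k fs) q b
                  & ~ coboundary_mod (take k fs) q b].
  exact: leq_addr.
elim=> [_|k IHk lt_k]; first by exists p, c; rewrite take0.
have [q [b [Dp cyc_b nbd_b]]] := IHk (ltnW lt_k).
have [|q' [b' [Dq cyc_b' nbd_b']]] :=
  regular_step (fs_reg k lt_k) _ cyc_b nbd_b.
  by apply: fs_rad; rewrite mem_nth.
by exists q', b'; rewrite (take_nth 0) // addSnnS -Dq.
Qed.

End DepthBound.

(** * Monomial ideals and their primary components *)

Lemma radicalD (R : comNzRingType) (J : set R) f g :
    (forall u v, J u -> J v -> J (u + v)) -> (forall a u, J u -> J (a * u)) ->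
  radical J f -> radical J g -> radical J (f + g).
Proof.
move=> JD JM [a Jf] [b Jg]; exists (a + b)%N; rewrite exprDn.
have J0 : J 0 by rewrite -[0](mul0r (f ^+ a)); apply: JM.
apply: big_ind => [//|//|i _]; rewrite -mulr_natl; apply: (JM _ _).
have [le_bi | lt_ib] := leqP b i.
  by rewrite -{2}(subnK le_bi) exprD; rewrite mulrA; apply: JM.
have le_a : (a <= a + b - i)%N by rewrite -addnBA ?leq_addr ?(ltnW lt_ib).
by rewrite mulrC -(subnK le_a) exprD; rewrite mulrA; apply: JM.
Qed.

Lemma radicalM (R : comNzRingType) (J : set R) a f :
  (forall b u, J u -> J (b * u)) -> radical J f -> radical J (a * f).
Proof. by move=> JM [k Jf]; exists k; rewrite exprMn; apply: JM. Qed.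

Section IdealGenerators.
Variables (R : comNzRingType) (G : set R).

Lemma ideal_genM a f : ideal_gen G f -> ideal_gen G (a * f).
Proof.
move=> [r [b [g [Gg ->]]]]; exists r, (fun i => a * b i), g; split=> //.
by rewrite mulr_sumr; apply: eq_bigr => i _; rewrite mulrA.
Qed.

Lemma ideal_genD f g : ideal_gen G f -> ideal_gen G g -> ideal_gen G (f + g).
Proof.
move=> [r1 [a1 [g1 [Gg1 ->]]]] [r2 [a2 [g2 [Gg2 ->]]]].
pose glue (h1 : 'I_r1 -> R) (h2 : 'I_r2 -> R) i :=
  match split i with inl j => h1 j | inr j => h2 j end.
exists (r1 + r2)%N, (glue a1 a2), (glue g1 g2); split=> [i|].
  by rewrite /glue; case: splitP.
rewrite big_split_ord; congr (_ + _); apply: eq_bigr => i _.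
  by rewrite /glue (unsplitK (inl i)).
by rewrite /glue (unsplitK (inr i)).
Qed.

Lemma mem_ideal_gen f : G f -> ideal_gen G f.
Proof.
by move=> Gf; exists 1%N, (fun=> 1), (fun=> f); rewrite big_ord1 mul1r.
Qed.

Lemma ideal_gen_min (J : set R) f :
    J 0 -> (forall u v, J u -> J v -> J (u + v)) ->
    (forall a u, J u -> J (a * u)) -> (forall g, G g -> J g) ->
  ideal_gen G f -> J f.
Proof.
move=> J0 JD JM JG [r [a [g [Gg ->]]]].
by apply: big_ind => // i _; apply/JM/JG.
Qed.

End IdealGenerators.

Section MonomialIdeals.
Variables (K : fieldType) (n : nat).
Local Notation S := {mpoly K[n]}.
Implicit Types (I Q : idealr S) (f : S) (m : 'X_{1..n}).

Lemma monomial_ideal_supp I f m :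
  monomial_ideal I -> f \in I -> m \in msupp f -> 'X_[m] \in I.
Proof.
move=> [G IG] If.
have [r [a [g [g_G ->]]]] : ideal_gen [set ('X_[m] : S) | m in G]%classic f.
  by rewrite -IG.
move=> /msupp_sum_le/flattenP[_ /mapP[i _ ->]].
have [m0 Gm0 Dg] := g_G i; rewrite -Dg.
rewrite (perm_mem (msuppMX _ _)) => /mapP[m1 _ ->].
rewrite mpolyXD mulrC idealMr //.
suff: [set` I]%classic ('X_[m0] : S) by [].
by rewrite IG; apply: mem_ideal_gen; exists m0.
Qed.

Lemma mcoeff_monomial_ideal I f m :
  monomial_ideal I -> f \in I -> 'X_[m] \notin I -> f@_m = 0.
Proof.
move=> monoI If nIm; apply: memN_msupp_eq0.
by apply: contra nIm; apply: monomial_ideal_supp.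
Qed.

Lemma lem_ideal I m1 m2 :
  (m1 <= m2)%MM -> 'X_[m1] \in I -> 'X_[m2] \in I.
Proof. by move=> /submK<-; rewrite mpolyXD => /idealMr; apply. Qed.

Lemma mnm_neq0 m : m != 0%MM -> exists v, m v != 0%N.
Proof.
move=> m_n0; apply/existsP; apply: contraR m_n0; rewrite negb_exists.
by move=> /forallP m0; apply/eqP/mnmP => v; rewrite mnm0E; apply/eqP/negPn/m0.
Qed.

(** The variables that generate the radical of a primary monomial ideal. *)
Definition radical_vars Q : {set 'I_n} :=
  [set v | `[< exists k, ('X_v : S) ^+ k \in Q >]].

(** As Q is primary, if it contains x^m, then it contains a power of a variable
    of x^m, or else 1. *)
Lemma radical_vars0 Q m : (forall v, v \in radical_vars Q -> m v = 0%N) ->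
  primary_ideal Q -> 'X_[m] \notin Q.
Proof.
move=> m0 primQ; apply/negP; have [d] := ubnP (mdeg m).
elim: d m m0 => // d IHd m m0; rewrite ltnS => le_d.
have [->|/mnm_neq0[v m_v]] := eqVneq m 0%MM; first by rewrite mpolyX0 idealr1.
have Dm : m = (m - U_(v) + U_(v))%MM.
  rewrite submK //; apply/mnm_lepP => w; rewrite mnm1E.
  by case: eqP => // <-; rewrite lt0n.
move: le_d; rewrite Dm mdegD mdeg1 addn1 mpolyXD => le_d.
case/primQ => [|Qv]; first by apply: IHd => // w Vw; rewrite mnmBE m0.
have : v \in radical_vars Q by rewrite inE; apply/asboolP.
by move=> /m0 mv0; rewrite mv0 in m_v.
Qed.

(** A variable outside the radical is a nonzerodivisor modulo Q, so its exponent
    is irrelevant for membership in Q. *)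
Lemma primary_mono Q m1 m2 :
    primary_ideal Q -> (forall v, v \in radical_vars Q -> (m1 v <= m2 v)%N) ->
  'X_[m1] \in Q -> 'X_[m2] \in Q.
Proof.
move=> primQ le_m12 Qm1.
pose r := [multinom if v \in radical_vars Q then m1 v else 0%N | v < n].
have le_r1 : (r <= m1)%MM by apply/mnm_lepP => v; rewrite mnmE; case: ifP.
have /lem_ideal : (r <= m2)%MM.
  by apply/mnm_lepP => v; rewrite mnmE; case: ifP => // /le_m12.
apply; move: Qm1; rewrite -(submK le_r1) addmC mpolyXD => /primQ[//|[k]].
rewrite mpolyXn; apply: contraLR => _; apply: radical_vars0 => // v Vv.
by rewrite mulmnE mnmBE mnmE Vv subnn.
Qed.

(** The substitution of 0 for the variables of the radical kills Q, hence also
    every f with a power in Q, because polynomials have no nilpotents. *)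
Lemma radical_supp Q f m :
    monomial_ideal Q -> primary_ideal Q -> radical [set` Q]%classic f ->
  m \in msupp f -> exists2 v, v \in radical_vars Q & m v != 0%N.
Proof.
move=> monoQ primQ [k Qfk] f_m.
pose h := [tuple if v \in radical_vars Q then 0 else 'X_v : S | v < n].
have hX0 m0 v : v \in radical_vars Q -> m0 v != 0%N -> 'X_[m0] \mPo h = 0.
  move=> Vv m0v; rewrite comp_mpolyX (bigD1 v) //= tnth_mktuple Vv expr0n.
  by rewrite (negPf m0v) mul0r.
have hX m0 : (forall v, v \in radical_vars Q -> m0 v = 0%N) ->
    'X_[m0] \mPo h = 'X_[m0].
  move=> m00; rewrite comp_mpolyX [RHS]mpolyXE_id; apply: eq_bigr => v _.
  by rewrite tnth_mktuple; case: ifP => // /m00 ->; rewrite !expr0.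
have VP m0 : (exists2 v, v \in radical_vars Q & m0 v != 0%N) \/
    (forall v, v \in radical_vars Q -> m0 v = 0%N).
  have [/exists_inP|] := boolP [exists v in radical_vars Q, m0 v != 0%N].
    by left.
  by rewrite negb_exists_in => /forall_inP m00; right=> v /m00/negPn/eqP.
have fh0 : f \mPo h = 0.
  have /eqP : (f ^+ k) \mPo h = 0.
    rewrite comp_mpolyEX big_seq big1 // => m1 fk_m1.
    have [[v Vv m1v]|m10] := VP m1; first by rewrite (hX0 _ v) ?scaler0.
    case/negP: (radical_vars0 m10 primQ).
    exact: monomial_ideal_supp monoQ Qfk fk_m1.
  by rewrite rmorphXn expf_eq0 => /andP[_ /eqP].
have [//|m_V] := VP m; move: (f_m); rewrite mcoeff_msupp.
suff <- : (f \mPo h)@_m = f@_m by rewrite fh0 mcoeff0 eqxx.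
rewrite comp_mpolyEX raddf_sum (bigD1_seq m) ?msupp_uniq //=.
rewrite mcoeffZ hX // mcoeffX eqxx mulr1 big1 ?addr0 // => m1 ne_m1.
have [[v Vv m1v]|m10] := VP m1; first by rewrite (hX0 _ v) ?scaler0 ?mcoeff0.
by rewrite hX // mcoeffZ mcoeffX (negPf ne_m1) mulr0.
Qed.

Lemma radical_supp_mem Q f :
    (forall m, m \in msupp f ->
       exists2 v, v \in radical_vars Q & m v != 0%N) ->
  radical [set` Q]%classic f.
Proof.
move=> fV; rewrite (mpolyE f) big_seq.
have QD u v : [set` Q]%classic u -> [set` Q]%classic v ->
  [set` Q]%classic (u + v) by exact: rpredD.
have QM a u : [set` Q]%classic u -> [set` Q]%classic (a * u).
  exact: idealMr.
apply: big_ind => [|f1 f2|m /fV[v Vv m_v]]; [|exact: radicalD|].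
  by exists 1%N; exact: idealr0.
have le_vm : (U_(v) <= m)%MM.
  by apply/mnm_lepP => w; rewrite mnm1E; case: eqP => // <-; rewrite lt0n.
rewrite -mul_mpolyC -(submK le_vm) mpolyXD mulrA; apply: radicalM => //.
by move: Vv; rewrite inE => /asboolP.
Qed.

(** If every variable of P_i occurred in some other P_j, then every monomial of
    an element of P_i would lie in some other P_j. *)
Lemma exists_private_var (s : nat) (Q : 'I_s -> idealr S) (P : 'I_s -> set S)
    (i : 'I_s) :
    (forall j, monomial_ideal (Q j)) -> (forall j, primary_ideal (Q j)) ->
    (forall j, P j = radical [set` Q j]%classic) ->
    ~ (P i `<=` ideal_sum (fun j => j != i) P)%classic ->
  exists v, v \in radical_vars (Q i) /\
    forall j, j != i -> v \notin radical_vars (Q j).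
Proof.
move=> monoQ primQ PE; apply: contra_notP => no_v f.
rewrite PE => /radical_supp fV.
have j_ex m : exists j, m \in msupp f ->
    j != i /\ exists2 v, v \in radical_vars (Q j) & m v != 0%N.
  have [/(fV _ (monoQ i) (primQ i))[v Vv m_v]|nf_m] := boolP (m \in msupp f);
    last by exists i.
  have /existsNP[j /not_implyP[ne_j /negP/negPn Vjv]] :
      ~ forall j, j != i -> v \notin radical_vars (Q j).
    by move=> v_priv; apply: no_v; exists v.
  by exists j => _; split=> //; exists v.
have [J JP] := choice j_ex.
exists (fun j => \sum_(m <- msupp f | (m \in msupp f) && (J m == j))
  f@_m *: 'X_[m]); split; last first.
  rewrite {1}(mpolyE f) big_seq (partition_big J (fun j => j != i)) //.
  by move=> m /JP[].
move=> j ne_j; rewrite PE; apply: radical_supp_mem => m.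
move=> /msupp_sum_le/flattenP[_ /mapP[m1 + ->]].
rewrite mem_filter => /andP[/andP[f_m1 /eqP Dj] _] /msuppZ_le.
by rewrite msuppX inE => /eqP->; have [_] := JP m1 f_m1; rewrite Dj.
Qed.

Lemma max_ideal_radical N f :
  max_ideal f ->
  radical (ideal_gen (range (fun v : 'I_n => 'X_[U_(v) *+ N] : S))%classic) f.
Proof.
set J := ideal_gen _.
have JD u v : J u -> J v -> J (u + v) by exact: ideal_genD.
have JM a u : J u -> J (a * u) by exact: ideal_genM.
apply: ideal_gen_min => [|u v|a u|_ [v _ <-]].
- exists 1%N; rewrite expr1 -[0](mul0r (0 : S)).
  by exists 0%N, (fun=> 0), (fun=> 0); rewrite big_ord0 mul0r; split=> // -[].
- exact: radicalD.
- exact: radicalM.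
by exists N; rewrite mpolyXn; apply: mem_ideal_gen; exists v.
Qed.

Lemma exists_vars_exponent (s : nat) (Q : 'I_s -> idealr S) :
  exists N, (0 < N)%N /\
    forall i m v, v \in radical_vars (Q i) -> (N <= m v)%N -> 'X_[m] \in Q i.
Proof.
have k_ex (iv : 'I_s * 'I_n) : exists k,
    iv.2 \in radical_vars (Q iv.1) -> 'X_[U_(iv.2) *+ k] \in Q iv.1.
  have [|_] := boolP (iv.2 \in radical_vars (Q iv.1)); last by exists 0%N.
  by rewrite inE => /asboolP[k Qk]; exists k; rewrite -mpolyXn.
have [k kP] := choice k_ex; exists (\max_iv k iv).+1; split=> // i m v Vv lt_m.
apply: lem_ideal (kP (i, v) Vv); apply/mnm_lepP => w; rewrite mulmnE mnm1E.
case: eqP => [<-|_] //=; rewrite mul1n; apply: leq_trans (ltnW lt_m).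
exact: (leq_bigmax (i, v)).
Qed.

End MonomialIdeals.

(** * Stanley decompositions from partitions of monomials *)

Lemma supremum_nat_le (A : set nat) d :
  (forall a, A a -> (a <= d)%N) -> (supremum 0%N A <= d)%N.
Proof.
move=> A_le; rewrite /supremum; case: ifP => // _.
case: xgetP => // a _ [_ /(_ d)]; rewrite leEnat; apply.
by move=> b /A_le; rewrite leEnat.
Qed.

Lemma le_supremum_nat (A : set nat) d e :
  (forall a, A a -> (a <= e)%N) -> A d -> (d <= supremum 0%N A)%N.
Proof.
move=> A_le A_d; rewrite -leEnat; apply: ge_supremum_Nmem A_d.
by apply: nat_supremums_neq0; exists e => b /A_le; rewrite leEnat.
Qed.

Section QuotMod.
Variables (R : comNzRingType) (I : idealr R).
Implicit Types (f g : R) (v : quotmod I).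

Lemma quotmod_pi0 : quotmod_pi I 0 = 0.
Proof. exact: (raddf0 \pi_({ideal_quot I})%qT). Qed.

Lemma quotmod_piD f g : quotmod_pi I (f + g) = quotmod_pi I f + quotmod_pi I g.
Proof. exact: (raddfD \pi_({ideal_quot I})%qT). Qed.

Lemma quotmod_pi_sum (T : Type) (r : seq T) (A : pred T) (F : T -> R) :
  quotmod_pi I (\sum_(i <- r | A i) F i) =
  \sum_(i <- r | A i) quotmod_pi I (F i).
Proof. by apply: big_morph; [exact: quotmod_piD | exact: quotmod_pi0]. Qed.

Lemma quotmod_piZ f g : f *: quotmod_pi I g = quotmod_pi I (f * g).
Proof. by rewrite /quotmod_pi rmorphM. Qed.

Lemma quotmod_pi_eq f g : quotmod_pi I f = quotmod_pi I g <-> f - g \in I.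
Proof. by rewrite Quotient.idealrBE; split=> [/eqP|/eqP]. Qed.

Lemma quotmod_pi_surj v : exists f, v = quotmod_pi I f.
Proof. by exists (repr (v : {ideal_quot I})); rewrite /quotmod_pi reprK. Qed.

End QuotMod.

Section MonomialPartition.
Variables (K : fieldType) (n : nat) (I : idealr {mpoly K[n]}).
Local Notation S := {mpoly K[n]}.
Implicit Types (f g : S) (m : 'X_{1..n}) (u : 'X_{1..n}) (Z : {set 'I_n}).

(** The exponents of the monomials in the Stanley space x^u K[Z]. *)
Definition monomial_box u Z m : bool :=
  (u <= m)%MM && [forall v, (v \in Z) || (m v == u v)].

Lemma monomial_boxP u Z m :
  reflect ((u <= m)%MM /\ forall v, v \notin Z -> m v = u v)
    (monomial_box u Z m).
Proof.
apply: (iffP andP) => -[le_um uZ]; split=> //.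
  by move=> v nZv; have /forallP/(_ v) := uZ; rewrite (negPf nZv) => /eqP.
apply/forallP => v; have [//|nZv] := boolP (v \in Z).
by rewrite uZ ?eqxx.
Qed.

Lemma subpoly_box u Z g m :
  subpoly Z g -> m \in msupp g -> monomial_box u Z (m + u).
Proof.
move=> Zg g_m; apply/monomial_boxP; split; first exact: lem_addl.
by move=> v nZv; rewrite mnmDE (Zg _ g_m).
Qed.

Lemma subpolyB Z f g : subpoly Z f -> subpoly Z g -> subpoly Z (f - g).
Proof.
move=> Zf Zg m /msuppB_le; rewrite mem_cat => /orP[f_m|g_m] v nZv.
  exact: Zf f_m v nZv.
exact: Zg g_m v nZv.
Qed.

Lemma subpoly0 Z : @subpoly K n Z 0.
Proof. by move=> m; rewrite msupp0. Qed.

Variables (r : nat) (u : 'I_r -> 'X_{1..n}) (Z : 'I_r -> {set 'I_n}).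
Hypothesis monoI : monomial_ideal I.
Hypothesis box_cover : forall m,
  ('X_[m] : S) \notin I -> exists k, monomial_box (u k) (Z k) m.
Hypothesis box_out : forall k m,
  monomial_box (u k) (Z k) m -> ('X_[m] : S) \notin I.
Hypothesis box_inj : forall k l m,
  monomial_box (u k) (Z k) m -> monomial_box (u l) (Z l) m -> k = l.

(** The monomials of the products g_k x^(u_k) lie outside I, and those for
    distinct k are distinct. *)
Lemma box_indep (g : 'I_r -> S) :
    (forall k, subpoly (Z k) (g k)) -> \sum_k g k * 'X_[u k] \in I ->
  forall k, g k = 0.
Proof.
move=> Zg Ig k; apply/mpolyP => m; rewrite mcoeff0.
have [g_m|] := boolP (m \in msupp (g k)); last exact: memN_msupp_eq0.
have := subpoly_box (u k) (Zg k) g_m; rewrite addmC => box_m.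
have := mcoeff_monomial_ideal monoI Ig (box_out box_m).
rewrite raddf_sum (bigD1 k) //= mcoeffMX big1 ?addr0 // => l ne_l.
apply: memN_msupp_eq0; apply: contra ne_l; rewrite (perm_mem (msuppMX _ _)).
case/mapP => m1 g_m1 Dm.
apply/eqP; apply: (box_inj _ box_m).
by rewrite Dm addmC; apply: subpoly_box g_m1.
Qed.

Definition box_generator k : quotmod I := quotmod_pi I 'X_[u k].

Lemma box_free k :
  free_over (Z k) (stanley_piece (box_generator k) (Z k)).
Proof.
exists 1%N, (fun=> box_generator k); split=> [_|_ [g Zg <-]].
  exists 1; last by rewrite scale1r.
  by move=> m; rewrite msupp1 inE => /eqP-> v _; rewrite mnm0E.
exists [ffun=> g]; split=> [|c [Zc]].
  by split=> [j|]; rewrite ?big_ord1 ffunE.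
rewrite big_ord1 !quotmod_piZ => /quotmod_pi_eq; rewrite -mulrBl => Igc.
pose d l := if l == k then g - c ord0 else 0.
have /(_ k) : forall l, d l = 0.
  apply: box_indep => [l|].
    by rewrite /d; case: eqP => [->|_]; [apply: subpolyB | apply: subpoly0].
  rewrite (bigD1 k) //= /d eqxx big1 ?addr0 // => l /negPf->.
  by rewrite mul0r.
rewrite /d eqxx => /eqP; rewrite subr_eq0 => /eqP gc.
by apply/ffunP => j; rewrite ffunE gc (ord1 j).
Qed.

Definition box_part f k : S :=
  \sum_(m <- msupp f | monomial_box (u k) (Z k) m) f@_m *: 'X_[m - u k].

Lemma subpoly_box_part f k : subpoly (Z k) (box_part f k).
Proof.
move=> m /msupp_sum_le/flattenP[_ /mapP[m1 + ->]] /msuppZ_le.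
rewrite mem_filter msuppX inE => /andP[/monomial_boxP[_ m1Z] _] /eqP-> v nZv.
by rewrite mnmBE m1Z ?subnn.
Qed.

Lemma sum_box_part f : f - \sum_k box_part f k * 'X_[u k] \in I.
Proof.
pose t m k : S := if monomial_box (u k) (Z k) m then f@_m *: 'X_[m] else 0.
have -> : \sum_k box_part f k * 'X_[u k] = \sum_(m <- msupp f) \sum_k t m k.
  rewrite exchange_big /=; apply: eq_bigr => k _; rewrite -big_mkcond /=.
  rewrite mulr_suml; apply: eq_bigr => m /monomial_boxP[le_um _].
  by rewrite -scalerAl -mpolyXD submK.
rewrite {1}(mpolyE f) -sumrB; apply: rpred_sum => m _.
have [If|/[dup] nIf /box_cover[k box_m]] := boolP (('X_[m] : S) \in I).
  rewrite big1 ?subr0 => [|k _]; last first.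
    by rewrite /t; case: ifP => // /box_out; rewrite If.
  by rewrite -mul_mpolyC idealMr.
rewrite (bigD1 k) //= /t box_m big1 ?addr0 ?subrr ?idealr0 // => l ne_l.
by case: ifP => // /box_inj/(_ box_m) Dl; rewrite Dl eqxx in ne_l.
Qed.

(** Every f is congruent modulo I to the sum of its parts in the boxes, and this
    decomposition is unique by box_indep. *)
Lemma stanley_decomposition_box :
  stanley_decomposition (@quot_homogeneous K n I) box_generator Z.
Proof.
split=> [k||v]; [|exact: box_free|].
  by exists 1, (u k); rewrite scale1r.
have [f ->] := quotmod_pi_surj v.
exists [ffun k => box_part f k *: box_generator k]; split.
  split=> [k|].
    by rewrite ffunE; exists (box_part f k) => //; exact: subpoly_box_part.
  under eq_bigr => k _ do rewrite ffunE quotmod_piZ.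
  by rewrite -quotmod_pi_sum; apply/quotmod_pi_eq; exact: sum_box_part.
move=> w [Zw Df].
have g_ex k : exists g, subpoly (Z k) g /\ g *: box_generator k = w k.
  by have [g Zg <-] := Zw k; exists g.
have [g gP] := choice g_ex.
have /box_indep Dg : forall k, subpoly (Z k) (box_part f k - g k).
  by move=> k; apply: subpolyB; [exact: subpoly_box_part | case: (gP k)].
apply/ffunP => k; rewrite ffunE -(gP k).2; congr (_ *: _).
apply/eqP; rewrite -subr_eq0; apply/eqP; move: k; apply: Dg.
under eq_bigr => k _ do rewrite mulrBl.
rewrite sumrB -[X in X - _](subrK f) -addrA; apply: rpredD.
  by rewrite -opprB rpredN sum_box_part.
apply/quotmod_pi_eq; rewrite Df quotmod_pi_sum; apply: eq_bigr => k _.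
by rewrite -(gP k).2 quotmod_piZ.
Qed.

End MonomialPartition.

Lemma le_sdepth (K : fieldType) (n : nat) (I : idealr {mpoly K[n]})
    (T : finType) (u : T -> 'X_{1..n}) (Z : T -> {set 'I_n}) (d : nat) :
    monomial_ideal I ->
    (forall m, ('X_[m] : {mpoly K[n]}) \notin I ->
       exists k, monomial_box (u k) (Z k) m) ->
    (forall k m, monomial_box (u k) (Z k) m ->
       ('X_[m] : {mpoly K[n]}) \notin I) ->
    (forall k l m, monomial_box (u k) (Z k) m -> monomial_box (u l) (Z l) m ->
       k = l) ->
    (forall k, (d <= #|Z k|)%N) -> (d <= n)%N ->
  (d <= sdepth (@quot_homogeneous K n I))%N.
Proof.
move=> monoI cover out inj le_dZ le_dn; pose e (i : 'I_#|T|) := enum_val i.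
have dec := @stanley_decomposition_box K n I _ (u \o e) (Z \o e) monoI.
apply: (@leq_trans (sdepth_decomposition (Z \o e))).
  rewrite /sdepth_decomposition; elim/big_ind: _ => [//|a b le_da le_db|i _ /=] //.
  by rewrite leq_min le_da.
apply: le_supremum_nat (n) _ _ => [_ [r [z [Z1 [_ <-]]]]|].
  rewrite /sdepth_decomposition; elim/big_ind: _ => [//|a b le_an _|i _].
    by rewrite (leq_trans (geq_minl _ _)).
  by rewrite -[leqRHS]card_ord max_card.
do 3!eexists; split; [apply: dec | by []].
- move=> m /cover[k box_m]; exists (enum_rank k).
  by rewrite /e /= enum_rankK.
- by move=> k m; apply: out.
by move=> k l m box_k /(inj _ _ _ box_k)/enum_val_inj.
Qed.

(** * Components with private variables *)

Section PrivateVariables.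
Variables (K : fieldType) (n s : nat) (I : idealr {mpoly K[n]}).
Local Notation S := {mpoly K[n]}.
Variables (Q : 'I_s -> idealr S) (y : 'I_s -> 'I_n) (N : nat).
Implicit Types (i j : 'I_s) (v w : 'I_n) (m : 'X_{1..n}).

Hypothesis Q_primary : forall i, primary_ideal (Q i).
Hypothesis Q_cap : is_intersection I Q.
Local Notation V i := (radical_vars (Q i)).
Hypothesis y_in : forall i, y i \in V i.
Hypothesis y_priv : forall i j, j != i -> y i \notin V j.
Hypothesis N_gt0 : (0 < N)%N.
Hypothesis N_pow : forall i m v,
  v \in V i -> (N <= m v)%N -> ('X_[m] : S) \in Q i.

Lemma y_inP i j : (y i \in V j) = (i == j).
Proof.
have [->|ne_ij] := eqVneq i j; first exact: y_in.
by apply/negbTE/y_priv; rewrite eq_sym.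
Qed.

Lemma y_inj : injective y.
Proof. by move=> i j Dy; apply/eqP; rewrite -y_inP Dy y_in. Qed.

Definition common_free : {set 'I_n} := ~: \bigcup_i V i.

Lemma common_freeP v : reflect (forall i, v \notin V i) (v \in common_free).
Proof.
rewrite inE; apply: (iffP idP) => [nVv i|nVv].
  by apply: contra nVv => Vv; apply/bigcupP; exists i.
by apply/bigcupP => -[i _]; apply/negP.
Qed.

Lemma cap_monomialP m :
  reflect (exists i, ('X_[m] : S) \notin Q i) (('X_[m] : S) \notin I).
Proof.
apply: (iffP idP) => [nIm|[i]]; last by apply: contra => /Q_cap.
apply/existsP; apply: contraR nIm; rewrite negb_exists => /forallP Qm.
by apply/Q_cap => i; have /negPn := Qm i.
Qed.

(** * The Stanley decomposition of S/I *)

(** In the part of S/I spanned by the monomials outside Q_i that lie in the Q_j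
    with j < i, the variables that may be multiplied without bound. *)
Definition free_vars i : {set 'I_n} := common_free :|: y @: [set~ i].

Lemma card_free_vars i : #|free_vars i| = (#|common_free| + s.-1)%N.
Proof.
rewrite cardsU disjoint_setI0 ?cards0 ?subn0.
  by rewrite card_imset ?cardsC1 ?card_ord //; exact: y_inj.
rewrite disjoints_subset; apply/subsetP => v /common_freeP nVv; rewrite inE.
by apply/imsetP => -[j _ Dv]; have := nVv j; rewrite Dv y_in.
Qed.

Lemma free_vars_in i j v : v \in free_vars i -> v \in V j -> v = y j.
Proof.
rewrite inE => /orP[/common_freeP/(_ j)/negPf-> //|/imsetP[l _ ->]].
by rewrite y_inP => /eqP->.
Qed.

Lemma free_vars_notin i v : v \in free_vars i -> v \notin V i.
Proof.
case/setUP => [/common_freeP-> //|/imsetP[l + ->]].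
by rewrite in_setC1 y_inP.
Qed.

Definition box_index : finType := ('I_s * {ffun 'I_n -> 'I_N.+1})%type.

Definition box_corner (k : box_index) : 'X_{1..n} :=
  [multinom k.2 v : nat | v < n].

Definition box_vars (k : box_index) : {set 'I_n} :=
  free_vars k.1 :|: [set v | (N <= box_corner k v)%N].

(** The corners of the Stanley spaces: for the other variables the exponent is
    only recorded up to N, where membership in the components stabilizes, and
    for the free ones it is as small as the Q_j with j < i allow. *)
Definition box_valid (k : box_index) : bool :=
  [&& ('X_[box_corner k] : S) \notin Q k.1,
      [forall j : 'I_s, (j < k.1)%N ==> (('X_[box_corner k] : S) \in Q j)]
    & [forall (v | (v \in free_vars k.1) && (0 < box_corner k v)%N),
        exists j : 'I_s,
        (j < k.1)%N && (('X_[box_corner k - U_(v)] : S) \notin Q j)]].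

Lemma box_notin k m : box_valid k ->
  monomial_box (box_corner k) (box_vars k) m -> ('X_[m] : S) \notin Q k.1.
Proof.
case/and3P=> nQu _ _ /monomial_boxP[_ Dm]; apply: contra (nQu).
apply: primary_mono => // v Vv.
have [|/Dm->] := boolP (v \in box_vars k); last by [].
rewrite inE => /orP[/free_vars_notin|]; first by rewrite Vv.
rewrite inE => le_N; suff : ('X_[box_corner k] : S) \in Q k.1.
  by rewrite (negPf nQu).
exact: N_pow Vv le_N.
Qed.

Lemma box_in k m j : box_valid k ->
    monomial_box (box_corner k) (box_vars k) m -> (j < k.1)%N ->
  ('X_[m] : S) \in Q j.
Proof.
case/and3P=> _ /forallP/(_ j)/implyP Qu _ /monomial_boxP[le_um _] /Qu.
exact: lem_ideal.
Qed.

Lemma box_same_component k l m : box_valid k -> box_valid l ->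
    monomial_box (box_corner k) (box_vars k) m ->
    monomial_box (box_corner l) (box_vars l) m ->
  k.1 = l.1.
Proof.
move=> val_k val_l box_k box_l.
have [lt_kl|lt_lk|] := ltngtP k.1 l.1; last exact: val_inj.
  by have := box_notin val_k box_k; rewrite (box_in val_l).
by have := box_notin val_l box_l; rewrite (box_in val_k).
Qed.

Lemma box_nonfree k m v :
    monomial_box (box_corner k) (box_vars k) m -> v \notin free_vars k.1 ->
  box_corner k v = minn (m v) N.
Proof.
move=> /monomial_boxP[/mnm_lepP/(_ v) le_um Dm] nFv.
have le_uN : (box_corner k v <= N)%N by rewrite mnmE -ltnS.
have [|/Dm->] := boolP (v \in box_vars k); last by rewrite (minn_idPl _).
rewrite inE (negPf nFv) inE => le_Nu.
have Du : box_corner k v = N by apply/eqP; rewrite eqn_leq le_uN.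
by rewrite Du (minn_idPr _) // -Du.
Qed.

(** A component Q_j has at most one free variable, y_j.  Were the exponent of y_j
    larger in u_k than in u_l, it could be decreased without leaving Q_j. *)
Lemma box_corner_le k l m : box_valid k -> box_valid l ->
    monomial_box (box_corner k) (box_vars k) m ->
    monomial_box (box_corner l) (box_vars l) m ->
  (box_corner k <= box_corner l)%MM.
Proof.
move=> val_k val_l box_k box_l.
have Dkl := box_same_component val_k val_l box_k box_l.
apply/mnm_lepP => v; have [Fv|nFv] := boolP (v \in free_vars k.1); last first.
  by rewrite (box_nonfree box_k) // (box_nonfree box_l) // -Dkl.
rewrite leqNgt; apply/negP => lt_lk.
have /and3P[_ /forallP Qk /forallP/(_ v)] := val_k.
rewrite Fv (leq_ltn_trans _ lt_lk) //= => /existsP[j /andP[lt_j /negP]]; apply.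
have [Vv|nVv] := boolP (v \in V j); last first.
  have := Qk j; rewrite lt_j; apply: primary_mono => // w Vw.
  have ne_vw : (v == w) = false by apply: contraNF nVv => /eqP->.
  by rewrite mnmBE mnm1E ne_vw subn0.
have /and3P[_ /forallP/(_ j) + _] := val_l; rewrite -Dkl lt_j.
apply: primary_mono => // w Vw; rewrite mnmBE mnm1E.
have [<-|ne_vw] := eqVneq v w.
  by rewrite leq_subRL ?add1n // (leq_trans _ lt_lk).
have nFw : w \notin free_vars k.1.
  apply: contra ne_vw => Fw.
  by rewrite (free_vars_in Fv Vv) (free_vars_in Fw Vw).
by rewrite subn0 (box_nonfree box_k) // (box_nonfree box_l) // -Dkl.
Qed.

Lemma box_unique k l m : box_valid k -> box_valid l ->
    monomial_box (box_corner k) (box_vars k) m ->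
    monomial_box (box_corner l) (box_vars l) m ->
  k = l.
Proof.
move=> val_k val_l box_k box_l.
have Dkl := box_same_component val_k val_l box_k box_l.
have le_kl := box_corner_le val_k val_l box_k box_l.
have le_lk := box_corner_le val_l val_k box_l box_k.
case: k l Dkl le_kl le_lk {val_k val_l box_k box_l} => [i u] [j w] /= <-.
move=> /mnm_lepP le_uw /mnm_lepP le_wu; congr (_, _); apply/ffunP => v.
apply/val_inj/eqP; rewrite eqn_leq.
by have := le_uw v; have := le_wu v; rewrite !mnmE /= => -> ->.
Qed.

(** Decreasing a free exponent of a minimal admissible u breaks admissibility,
    which can only be the fault of some Q_j with j < i: this is the last condition
    of box_valid. *)
Lemma box_cover m : ('X_[m] : S) \notin I ->
  exists2 k, box_valid k & monomial_box (box_corner k) (box_vars k) m.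
Proof.
case/cap_monomialP => i0 nQm0.
pose out i := ('X_[m] : S) \notin Q i.
have [i nQm i_min] := @arg_minnP _ i0 out (fun i => i : nat) nQm0.
have Qm j : (j < i)%N -> ('X_[m] : S) \in Q j.
  by move=> lt_ji; apply: contraLR lt_ji => /i_min; rewrite -leqNgt.
pose corner (u : {ffun 'I_n -> 'I_N.+1}) := box_corner (i, u).
have cornerE (f : 'I_n -> nat) v : (f v <= N)%N ->
    corner [ffun w => inord (f w)] v = f v.
  by move=> le_fN; rewrite mnmE /= ffunE inordK.
(* The corner is a smallest u below the truncation of m that agrees with it on
   the non-free variables and stays in all Q_j with j < i. *)
pose admissible u := [&& [forall v, (corner u v <= minn (m v) N)%N],
  [forall (v | v \notin free_vars i), corner u v == minn (m v) N]
  & [forall j : 'I_s, (j < i)%N ==> (('X_[corner u] : S) \in Q j)]].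
pose u0 := [ffun v : 'I_n => inord (minn (m v) N) : 'I_N.+1].
have u0E v : corner u0 v = minn (m v) N by rewrite cornerE ?geq_minr.
have adm_u0 : admissible u0.
  apply/and3P; split; [apply/forallP => v | apply/forall_inP => v _ |].
  - by rewrite u0E.
  - by rewrite u0E.
  apply/forallP => j; apply/implyP => /Qm Qjm.
  have [/exists_inP[v Vv le_Nm]|] := boolP [exists v in V j, (N <= m v)%N].
    by apply: (N_pow Vv); rewrite u0E (minn_idPr _).
  rewrite negb_exists_in => /forall_inP lt_mN; apply: primary_mono Qjm => //.
  by move=> v /lt_mN; rewrite -ltnNge u0E => /ltnW lt; rewrite (minn_idPl _).
have [u adm_u u_min] :=
  @arg_minnP _ u0 admissible (fun u => mdeg (corner u)) adm_u0.
have /and3P[/forallP le_u /forall_inP Du /forallP Qu] := adm_u.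
have le_um : (corner u <= m)%MM.
  by apply/mnm_lepP => v; apply: leq_trans (le_u v) (geq_minl _ _).
exists (i, u); last first.
  apply/monomial_boxP; split=> // v; rewrite in_setU => /norP[nFv].
  have /eqP Dv := Du v nFv; rewrite in_set -ltnNge -[box_corner _]/(corner u) Dv.
  by case: (leqP (m v) N) => //; rewrite ltnn.
apply/and3P; split=> //=; [| exact/forallP |].
  by apply: contra nQm; apply: lem_ideal.
apply/forallP => v; apply/implyP => /andP[Fv u_v].
rewrite -[X in is_true X]negbK negb_exists; apply/negP => /forallP Qj.
have le_vu : (U_(v) <= corner u)%MM.
  by apply/mnm_lepP => w; rewrite mnm1E; case: eqP => // <-.
pose u1 := [ffun w : 'I_n => inord (corner u w - (v == w)) : 'I_N.+1].
have Du1 : corner u1 = (corner u - U_(v))%MM.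
  apply/mnmP => w; rewrite cornerE ?mnmBE ?mnm1E //.
  rewrite leq_subLR (leq_trans (le_u w)) // (leq_trans (geq_minr _ _)) //.
  exact: leq_addl.
have adm_u1 : admissible u1.
  apply/and3P; rewrite Du1; split.
  - apply/forallP => w; rewrite mnmBE leq_subLR (leq_trans (le_u w)) //.
    exact: leq_addl.
  - apply/forall_inP => w nFw; rewrite mnmBE mnm1E.
    have [Dw|_] := eqVneq v w; first by rewrite -Dw Fv in nFw.
    by rewrite subn0 Du.
  apply/forallP => j; apply/implyP => lt_ji.
  by have := Qj j; rewrite lt_ji /= negbK.
have := u_min _ adm_u1.
by rewrite Du1 -{1}(submK le_vu) mdegD mdeg1 addn1 ltnn.
Qed.



Lemma private_le_sdepth : monomial_ideal I ->
  (#|common_free| + s.-1 <= sdepth (@quot_homogeneous K n I))%N.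
Proof.
move=> monoI; pose T := {k : box_index | box_valid k}.
apply: (@le_sdepth K n I T (box_corner \o val) (box_vars \o val)) => //.
- by move=> m /box_cover[k val_k box_m]; exists (exist _ k val_k).
- move=> k m box_m; apply/cap_monomialP; exists (val k).1.
  by apply: box_notin box_m; exact: valP.
- by move=> k l m /box_unique => H /H{}H; apply/val_inj/H; exact: valP.
- move=> k; rewrite -(card_free_vars (val k).1) subset_leq_card //.
  exact: subsetUl.
have /cap_monomialP[i _] : ('X_[0] : S) \notin I by rewrite mpolyX0 idealr1.
by rewrite -(card_free_vars i) -[leqRHS]card_ord max_card.
Qed.

(** * A nonzero Koszul cohomology class of S/I *)

Section KoszulClass.
Variable i0 : 'I_s.

(** A private variable comes first, since the orientation below leaves out the
    first vertex and has to take every common free variable into account. *)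
Definition vertices : seq 'I_n := codom y ++ enum common_free.

Lemma vertices_uniq : uniq vertices.
Proof.
rewrite cat_uniq enum_uniq map_inj_uniq ?enum_uniq ?andbT /=; last exact: y_inj.
apply/hasPn => v; rewrite mem_enum => /common_freeP nVv.
by apply/codomP => -[i Dv]; have := nVv i; rewrite Dv y_in.
Qed.

Local Notation d := (#|common_free| + s.-1)%N.
Local Notation E := (nth (y i0) vertices).

Lemma size_vertices : size vertices = d.+1.
Proof.
have s_gt0 : (0 < s)%N by rewrite -(card_ord s); apply/card_gt0P; exists i0.
by rewrite size_cat size_codom card_ord -cardE addnC -addnS prednK.
Qed.

Lemma y_in_vertices i : y i \in vertices.
Proof. by rewrite mem_cat codom_f. Qed.

Lemma common_free_vertices w : w \in common_free -> w \in vertices.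
Proof. by rewrite mem_cat mem_enum => ->; rewrite orbT. Qed.

Lemma first_vertex_notin_free : E 0 \notin common_free.
Proof.
suff [i ->] : exists i, E 0 = y i.
  by apply/negP => /common_freeP/(_ i); rewrite y_in.
have : E 0 \in codom y; last by case/codomP=> i; exists i.
have s_gt0 : (0 < size (codom y))%N.
  by rewrite size_codom; apply/card_gt0P; exists i0.
by rewrite /vertices nth_cat s_gt0 mem_nth.
Qed.

(** On the union of the V_i this retracts the simplicial complex with facets the
    complements of the V_i onto the boundary of the simplex on the y_i: a set of
    variables that avoids V_i is mapped to one that avoids y_i, because a
    variable is only sent to y_i if it lies in V_i. *)
Definition retract v : 'I_n := if [pick i | v \in V i] is Some i then y i else v.

Lemma retract_in_vertices v : retract v \in vertices.
Proof.
rewrite /retract; case: pickP => [i _|nVv]; first exact: y_in_vertices.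
by apply/common_free_vertices/common_freeP => i; rewrite nVv.
Qed.

Lemma retract_y i v : retract v = y i -> v \in V i.
Proof.
rewrite /retract; case: pickP => [j Vv /y_inj<- //|nVv Dv].
by have := nVv i; rewrite Dv y_in.
Qed.

Lemma retract_free v w : w \in common_free -> retract v = w -> v = w.
Proof.
move=> /common_freeP nVw; rewrite /retract; case: pickP => // i _ Dw.
by have := nVw i; rewrite -Dw y_in.
Qed.

Lemma retract_vertices v : v \in vertices -> retract v = v.
Proof.
rewrite mem_cat mem_enum => /orP[/codomP[i ->]|/common_freeP nVv]; last first.
  by rewrite /retract; case: pickP => // i; rewrite (negPf (nVv i)).
rewrite /retract; case: pickP => [j|/(_ i)]; last by rewrite y_in.
by rewrite y_inP => /eqP->.
Qed.

(** The pullback of the alternating cochain which is 1 or -1 on the orderings of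
    the face opposite to the first vertex of the simplex on all vertices, and 0
    on the other sequences. *)
Definition orientation (c : seq 'I_n) : K :=
  \det (\matrix_(k < d, j < d) (retract (nth (y i0) c k) == E j.+1)%:R).

Definition vertex_matrix (c : seq 'I_n) : 'M[K]_d.+1 :=
  \matrix_(k, j) if j == ord0 then 1
                 else (retract (nth (y i0) c k) == E j)%:R.

(** This is the expansion of the determinant along its column of ones. *)
Lemma orientation_diff c : size c = d.+1 ->
  \sum_(k < size c) (-1) ^+ k * orientation (omit k c) = \det (vertex_matrix c).
Proof.
move=> sz_c; rewrite sz_c (expand_det_col _ ord0); apply: eq_bigr => k _.
rewrite mxE eqxx mul1r /cofactor addn0; congr (_ * \det _).
apply/matrixP => i j; rewrite !mxE nth_omit ?sz_c //.
Qed.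

Lemma orientation_free c w :
  orientation c != 0 -> size c = d -> w \in common_free -> w \in c.
Proof.
move=> nz_c sz_c w_free; apply: contraNT nz_c => nw_c.
have lt_w : (index w vertices < d.+1)%N.
  by rewrite -size_vertices index_mem common_free_vertices.
have Ew : E (index w vertices) = w.
  by rewrite nth_index // common_free_vertices.
case Dj: (index w vertices) lt_w Ew => [|j] lt_j Ew.
  by have := first_vertex_notin_free; rewrite Ew w_free.
rewrite /orientation (expand_det_col _ (Ordinal (lt_j : (j < d)%N))).
rewrite big1 // => k _.
rewrite mxE /= Ew; case: eqP => [/(retract_free w_free) Dw|_]; last first.
  by rewrite mul0r.
by rewrite -Dw mem_nth ?sz_c in nw_c.
Qed.

Lemma det_vertex_matrix_vertices : \det (vertex_matrix vertices) = 1.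
Proof.
rewrite det_trig.
  apply: big1 => k _; rewrite mxE retract_vertices ?mem_nth ?size_vertices //.
  by rewrite eqxx; case: ifP.
apply/is_trig_mxP => k j lt_kj; rewrite mxE ifN.
  rewrite retract_vertices ?mem_nth ?size_vertices //.
  by rewrite nth_uniq ?size_vertices ?vertices_uniq // (ltn_eqF lt_kj).
by apply: contraTneq lt_kj => ->; rewrite ltn0.
Qed.

(** If two rows of the vertex matrix agree, its determinant vanishes; otherwise
    the d + 1 entries of c are retracted onto all d + 1 vertices, the y_i among
    them. *)
Lemma det_vertex_matrix_neq0 c i : size c = d.+1 ->
  \det (vertex_matrix c) != 0 -> exists2 v, v \in c & v \in V i.
Proof.
move=> sz_c nz_c.
have inj_c : uniq (map retract c).
  apply/(uniqP (y i0)) => k l; rewrite !inE size_map sz_c => lt_k lt_l.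
  rewrite !(nth_map (y i0)) ?sz_c // => Dkl; apply/eqP.
  apply: contraNT nz_c => ne_kl; apply/eqP.
  apply: (@determinant_alternate _ _ _ (Ordinal lt_k) (Ordinal lt_l)) => // j.
  by rewrite !mxE /= Dkl.
have sub_c : {subset map retract c <= vertices}.
  by move=> _ /mapP[v _ ->]; exact: retract_in_vertices.
have [|_ Dc] := uniq_min_size inj_c sub_c.
  by rewrite size_map sz_c size_vertices.
have : y i \in map retract c by rewrite Dc y_in_vertices.
by case/mapP => v c_v /esym/retract_y Vv; exists v.
Qed.

(** Koszul cochains of multidegree -N on W and 0 elsewhere have coefficients of
    these degrees.  The truncation of the subtraction is harmless, because the
    orientation vanishes on sequences missing a common free variable. *)
Definition cochain_exponent (c : seq 'I_n) : 'X_{1..n} :=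
  [multinom (N * (count_mem v c - (v \in common_free)))%N | v < n].

Lemma count_omit (a : pred 'I_n) k (c : seq 'I_n) : (k < size c)%N ->
  count a c = (a (nth (y i0) c k) + count a (omit k c))%N.
Proof.
move=> lt_k; rewrite -{1}(cat_take_drop k c) (drop_nth (y i0)) // !count_cat /=.
by rewrite addnCA.
Qed.

Lemma cochain_exponent_omit k (c : seq 'I_n) : (k < size c)%N ->
    (forall w, w \in common_free -> w \in omit k c) ->
  cochain_exponent c =
  (U_(nth (y i0) c k) *+ N + cochain_exponent (omit k c))%MM.
Proof.
move=> lt_k free_c; apply/mnmP => v; rewrite mnmDE mulmnE mnm1E !mnmE.
have le_v : ((v \in common_free) <= count_mem v (omit k c))%N.
  by case: (boolP (v \in _)) => // /free_c; rewrite -has_pred1 has_count.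
by rewrite (count_omit _ lt_k) /= -addnBA // mulnDr mulnC.
Qed.

Definition cochain (c : seq 'I_n) : S :=
  orientation c *: 'X_[cochain_exponent c].

(** The differential at c is the determinant of the vertex matrix times a
    monomial.  If the determinant is nonzero, then c meets every V_i, and the
    monomial lies in every Q_i because each entry of c contributes exponent N. *)
Lemma cochain_closed c : size c = d.+1 ->
  \sum_(k < size c) (-1) ^+ k *
    ('X_[U_(nth (y i0) c k) *+ N] * cochain (omit k c)) \in I.
Proof.
move=> sz_c.
have -> : \sum_(k < size c) (-1) ^+ k *
    ('X_[U_(nth (y i0) c k) *+ N] * cochain (omit k c)) =
    \det (vertex_matrix c) *: 'X_[cochain_exponent c].
  rewrite -orientation_diff // scaler_suml; apply: eq_bigr => k _.
  rewrite /cochain -scalerA -scalerAr.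
  have [->|nz_k] := eqVneq (orientation (omit k c)) 0.
    by rewrite !scale0r scaler0 mulr0.
  have sz_k : size (omit k c) = d by rewrite size_omit // sz_c.
  rewrite -mpolyXD -cochain_exponent_omit //; last first.
    by move=> w; apply: orientation_free.
  by rewrite -[RHS]mul_mpolyC rmorphXn rmorphN1.
have [->|nz_c] := eqVneq (\det (vertex_matrix c)) 0.
  by rewrite scale0r rpred0.
rewrite -mul_mpolyC idealMr //; apply/Q_cap => i.
have [v c_v Vv] := det_vertex_matrix_neq0 i sz_c nz_c.
apply: (N_pow Vv); rewrite mnmE.
have -> : (v \in common_free) = false.
  by apply/negP => /common_freeP/(_ i); rewrite Vv.
by rewrite subn0 leq_pmulr // -has_count has_pred1.
Qed.
Lemma mem_omit_vertices k v : (k < d.+1)%N ->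
  (v \in omit k vertices) = (v \in vertices) && (v != E k).
Proof.
move=> lt_k; have := count_omit (pred1 v) (etrans (congr1 _ size_vertices) lt_k).
rewrite count_uniq_mem ?vertices_uniq // -[v \in omit _ _]has_pred1 has_count /=.
rewrite [v == _]eq_sym.
have := mem_nth (y i0) (etrans (congr1 _ size_vertices) lt_k).
by case: eqP => [->->|_ _]; case: (v \in vertices); case: (count_mem v _) => // -[].
Qed.

(** A bounding cochain B would give, by extraction of coefficients, a scalar
    cochain whose differential is the orientation on the faces of the simplex on
    the vertices; this is impossible, as the alternating sum of the orientations
    of these faces is 1. *)
Lemma cochain_not_exact (B : seq 'I_n -> S) : monomial_ideal I ->
  ~ (forall c, size c = d -> cochain c - \sum_(k < size c) (-1) ^+ k *
       ('X_[U_(nth (y i0) c k) *+ N] * B (omit k c)) \in I).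
Proof.
move=> monoI exactB; pose full (c : seq 'I_n) := all [in c] (enum common_free).
have fullP c : reflect (forall w, w \in common_free -> w \in c) (full c).
  by apply: (iffP allP) => full_c w; have := full_c w; rewrite mem_enum.
pose b c : K^o := if full c then (B c)@_(cochain_exponent c) else 0.
suff Db k : (k < d.+1)%N -> orientation (omit k vertices) =
    koszul_diff (fun=> 1 : K) b (omit k vertices).
  have /eqP[] := oner_neq0 K; rewrite -det_vertex_matrix_vertices.
  rewrite -orientation_diff ?size_vertices //.
  rewrite -[RHS](koszul_diff_diff (fun=> 1 : K) b vertices).
  rewrite (koszul_diffE _ (y i0)) size_vertices; apply: eq_bigr => k _.
  by rewrite scale1r Db.
move=> lt_k; set c := omit k vertices.
have lt_kv : (k < size vertices)%N by rewrite size_vertices.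
have sz_c : size c = d by rewrite size_omit // size_vertices.
have [Ek_free|Ek_nfree] := boolP (E k \in common_free).
  have nc_Ek : E k \notin c by rewrite mem_omit_vertices // eqxx andbF.
  rewrite (koszul_diffE _ (y i0)) big1 => [|l _].
    by apply: contraNeq nc_Ek => /orientation_free; apply.
  rewrite /b; case: fullP => [/(_ _ Ek_free) c_Ek|_]; last by rewrite !scaler0.
  case/negP: nc_Ek; move: c_Ek; rewrite -!has_pred1 !has_count.
  by rewrite (count_omit _ (ltn_ord l)) addn_gt0 => ->; rewrite orbT.
have [i Ek] : exists i, E k = y i.
  have := mem_nth (y i0) lt_kv; rewrite mem_cat mem_enum (negPf Ek_nfree) orbF.
  by case/codomP=> i; exists i.
have full_c w : w \in common_free -> w \in c.
  move=> w_free; rewrite mem_omit_vertices // common_free_vertices //=.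
  by apply: contraNneq Ek_nfree => <-.
have nIc : ('X_[cochain_exponent c] : S) \notin I.
  apply/cap_monomialP; exists i; apply: radical_vars0 => // v Vv.
  rewrite mnmE; suff /count_memPn-> : v \notin c by rewrite sub0n muln0.
  rewrite mem_omit_vertices // Ek; apply/negP => /andP[+ /eqP ne_v].
  rewrite mem_cat mem_enum => /orP[/codomP[j Dv]|/common_freeP/(_ i)].
    by case: ne_v; move: Vv; rewrite Dv y_inP => /eqP->.
  by rewrite Vv.
have := mcoeff_monomial_ideal monoI (exactB c sz_c) nIc.
rewrite mcoeffB mcoeffZ mcoeffX eqxx mulr1 => /eqP; rewrite subr_eq0 => /eqP->.
rewrite raddf_sum (koszul_diffE _ (y i0)); apply: eq_bigr => l _ /=.
have -> : (-1 : S) ^+ l = ((-1) ^+ l)%:MP by rewrite rmorphXn rmorphN1.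
rewrite mcoeffCM scale1r; congr (_ * _).
rewrite /b mulrC; case: fullP => [/cochain_exponent_omit->//|not_full].
  by rewrite mcoeffMX.
(* The entry c_l is then a common free variable w which occurs only once in c, so
   that w has exponent 0 in the exponent of c. *)
have /existsNP[w /not_implyP[w_free /negP w_omit]] := not_full.
apply: memN_msupp_eq0; rewrite (perm_mem (msuppMX _ _)).
apply/mapP => -[m _ /mnmP/(_ w)]; rewrite mnmE mnmDE mulmnE mnm1E w_free.
have := full_c w w_free; rewrite -has_pred1 has_count.
rewrite (count_omit _ (ltn_ord l)) /= (count_memPn w_omit) addn0.
by case: eqP => //= _ _; rewrite subnn muln0 mul1n; case: (N) N_gt0.
Qed.

Lemma private_depth_le : monomial_ideal I -> (depth (quotmod I) <= d)%N.
Proof.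
move=> monoI; apply: supremum_nat_le => _ [fs [<- fs_max fs_reg]].
pose t v : S := 'X_[U_(v) *+ N].
have diff_pi B c : koszul_diff t (fun c0 => quotmod_pi I (B c0)) c =
    quotmod_pi I (\sum_(k < size c) (-1) ^+ k *
      ('X_[U_(nth (y i0) c k) *+ N] * B (omit k c))).
  rewrite (koszul_diffE _ (y i0)) quotmod_pi_sum; apply: eq_bigr => k _.
  by rewrite !quotmod_piZ.
have cochain_zero q c : zero_in_degree [::] q c <->
    forall x, size x = q -> c x = 0 :> quotmod I.
  split=> c0 x sz_x; last by rewrite c0 //; apply: seq_smul0.
  by have /seq_smulP[w ->] := c0 x sz_x; rewrite big_ord0.
apply: (regular_seq_size (t := t) (c := fun c => quotmod_pi I (cochain c))
  fs_reg).
- by move=> f /fs_max; apply: max_ideal_radical.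
- apply/cochain_zero => c sz_c.
  by rewrite diff_pi -(quotmod_pi0 I) quotmod_pi_eq subr0 cochain_closed.
case=> b /cochain_zero Db.
have [B BP] := choice (fun c => quotmod_pi_surj (b c)).
apply: (cochain_not_exact (B := B) monoI) => c /Db /eqP.
rewrite (eq_koszul_diff _ _ BP) diff_pi subr_eq0.
by move=> /eqP/quotmod_pi_eq.
Qed.

End KoszulClass.
End PrivateVariables.

Local Open Scope classical_set_scope.

Theorem theorem2p3 (K : fieldType) (n : nat) (I : idealr {mpoly K[n]})
    (I_neq0 : exists f : {mpoly K[n]}, f \in I /\ f != 0)
    (I_monomial : monomial_ideal I)
    (s : nat) (Q : 'I_s -> idealr {mpoly K[n]})
    (Q_monomial : forall i : 'I_s, monomial_ideal (Q i))
    (Q_primary : forall i : 'I_s, primary_ideal (Q i))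
    (Q_cap : is_intersection I Q)
    (Q_irredundant : irredundant Q)
    (P : 'I_s -> set {mpoly K[n]})
    (P_radical : forall i : 'I_s, P i = radical [set` Q i])
    (P_sum : forall i : 'I_s, ~ (P i `<=` ideal_sum (fun j => j != i) P)) :
  (depth (quotmod I) <= sdepth (@quot_homogeneous K n I))%N.
Proof.
have y_ex i := exists_private_var Q_monomial Q_primary P_radical (P_sum i).
have [y yP] := choice y_ex.
have y_in i : y i \in radical_vars (Q i) by case: (yP i).
have y_priv i j : j != i -> y i \notin radical_vars (Q j).
  by case: (yP i) => _; apply.
have [N [N_gt0 N_pow]] := exists_vars_exponent Q.
have /(cap_monomialP Q_cap)[i0 _] : ('X_[0] : {mpoly K[n]}) \notin I.
  by rewrite mpolyX0 idealr1.
apply: leq_trans (_ : _ <= #|common_free Q| + s.-1)%N _; last first.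
  exact: (private_le_sdepth Q_primary Q_cap y_in y_priv N_pow).
exact: (private_depth_le Q_primary Q_cap y_in y_priv N_gt0 N_pow i0).
Qed.
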